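(* Up to a rescaling of variables $x^i\mapsto d_ix^i$, $d_i\neq0$, the general orderable quadratic strict rime algebra with generators $x^1,\dots,x^n$ has relations (i) either of the form $$x^jx^k=-x^kx^j+g_{jk}x^kx^k,\qquad j<k,$$ with no conditions on the coefficients $g_{jk}$; (ii) or of the form $$x^jx^k=f\,x^kx^j+(1-f)\,x^kx^k,\qquad j<k,$$ with arbitrary $f$ (it is strict when $f\neq0,1$).
   Context: Consider an associative algebra generated by $x^1,\dots,x^n$ and defined by quadratic relations giving a lexicographical order: for $j<k$, $x^jx^k$ is a linear combination of terms $x^ax^b$ with $a\ge b$ and either $a>j$, or $a=j$ and $b>k$. The algebra is rime if only terms with $\{a,b\}\subset\{j,k\}$ occur, that is, the relations are $x^jx^k=f_{jk}x^kx^j+g_{jk}x^kx^k$ for $j<k$, with constants $f_{jk},g_{jk}$. It is strict if all $f_{jk}$ and $g_{jk}$, $j<k$, are different from zero. Orderable means that these relations, used as ordering rules (replacing $x^jx^k$, $j<k$, by the right-hand side), are consistent: the ordered forms of $(x^jx^k)x^l$ and $x^j(x^kx^l)$ coincide for all $j<k<l$, so that the ordered monomials form a basis of the algebra.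
   Formalization: For n = 2 the classification additionally assumes that the coefficient f_12 is not 1, since x^1x^2 = x^2x^1 + g x^2x^2 with g nonzero is strict and vacuously orderable but rescales to neither form (outside characteristic 2). *)

(* Defs.v *)
From Stdlib Require Import Relations.
From mathcomp Require Import all_boot all_algebra.
From mathcomp.multinomials Require Import monalg.

Set Implicit Arguments.
Unset Strict Implicit.
Unset Printing Implicit Defensive.

Import GRing.Theory.
Local Open Scope ring_scope.

(* The free associative algebra is the monoid algebra of the free monoid. *)
Notation word n := {fmonom 'I_n}.
Notation free_alg F n := {malg F[word n]}.

Section Rime.
Variables (F : fieldType) (n : nat).
Implicit Types (f g : 'I_n -> 'I_n -> F) (d : 'I_n -> F).
Implicit Types (p q : free_alg F n) (u v w : word n).

Definition gen (i : 'I_n) : free_alg F n := << fmu i >>.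

(* A rime algebra is given by its structure constants; here and below only the
   values f j k and g j k with j < k matter. *)
Definition rime_rhs f g (j k : 'I_n) : free_alg F n :=
  f j k *: (gen k * gen j) + g j k *: (gen k * gen k).

Definition rime_relator f g (j k : 'I_n) : free_alg F n :=
  gen j * gen k - rime_rhs f g j k.

Definition strict f g : Prop :=
  forall j k : 'I_n, (j < k)%N -> f j k <> 0 /\ g j k <> 0.

(* The rime algebra with constants f, g is the quotient of the free algebra by
   this two-sided ideal. *)
Inductive rime_ideal f g : free_alg F n -> Prop :=
| RimeRelator (j k : 'I_n) : (j < k)%N -> rime_ideal f g (rime_relator f g j k)
| RimeIdeal0 : rime_ideal f g 0
| RimeIdealD p q : rime_ideal f g p -> rime_ideal f g q -> rime_ideal f g (p + q)
| RimeIdealMl p q : rime_ideal f g q -> rime_ideal f g (p * q)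
| RimeIdealMr p q : rime_ideal f g p -> rime_ideal f g (p * q).

(* One application of the ordering rule x^j x^k |-> rime_rhs f g j k to the
   occurrences of the single word u x^j x^k v in p (so p is unchanged when this
   word does not occur in p). *)
Definition reduces1 f g p q : Prop :=
  exists u v (j k : 'I_n), (j < k)%N /\
    let w : word n := mmul u (mmul (fmu j) (mmul (fmu k) v)) in
    q = p - p@_w *: << w >> + p@_w *: (<< u >> * rime_rhs f g j k * << v >>).

Definition reduces f g : free_alg F n -> free_alg F n -> Prop :=
  clos_refl_trans (free_alg F n) (reduces1 f g).

Definition ordered p : Prop :=
  forall w, p@_w <> 0 -> sorted (fun a b : 'I_n => (b <= a)%N) w.

Definition ordered_form f g p q : Prop := reduces f g p q /\ ordered q.

(* The overlap x^j x^k x^l is first rewritten at (x^j x^k), resp. (x^k x^l);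
   the two results must have the same ordered form. *)
Definition orderable f g : Prop :=
  forall j k l : 'I_n, (j < k)%N -> (k < l)%N ->
    exists q, ordered_form f g (rime_rhs f g j k * gen l) q
           /\ ordered_form f g (gen j * rime_rhs f g k l) q.

(* The algebra endomorphism of the free algebra with x^i |-> d_i x^i. *)
Definition rescale d : free_alg F n -> free_alg F n :=
  mmap (fun c : F => c%:MP) (fun w : word n => \prod_(i <- w) (d i *: gen i)).

(* x^i |-> d_i x^i carries the defining ideal for (f, g) to that for (f', g'),
   i.e. it induces an isomorphism of the two algebras. *)
Definition rescales_to d f g f' g' : Prop :=
  (forall i, d i <> 0) /\
  (forall p, rime_ideal f g p <-> rime_ideal f' g' (rescale d p)).

End Rime.

(* Main.v *)
Require Import Defs.
From HB Require Import structures.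
From Stdlib Require Import Relations.
From mathcomp Require Import all_boot all_algebra ring.
From mathcomp.multinomials Require Import monalg.

(** For j < k < l the word x^j x^k x^l is the only word of length 3 in these
    letters on which two ordering rules compete.  Write a = f j k, b = f j l, c = f k l and
    A = g j k, B = g j l, C = g k l.  Ordering x^j x^k x^l in the two ways and
    comparing coefficients gives

    - on x^l x^l x^j : a b C = b^2 C,
    - on x^l x^k x^k : A c^2 = A b c,
    - on x^l x^l x^k : a c^2 B + A C c (1 + c) = c B,

    while x^l x^k x^j always agrees.  In the strict case the first two
    equations say a = b = c, so f is a constant c, and the third one becomes
    (1 + c) (A C - (1 - c) B) = 0; for constant f the comparison on x^l x^l x^l
    follows from it.  Hence either c = -1 and g is free, or
    g j k * g k l = (1 - c) * g j l, that is, g / (1 - c) is a multiplicative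
    cocycle.  It is then the coboundary of d^-1 with d_0 = 1 and
    d_k = (1 - c) / g 0 k, and the rescaling by d turns g into the constant
    1 - c.  The cocycle equation with A C <> 0 excludes c = 1 as soon as there
    are three generators; two generators give no overlap.

    Necessity ([overlap_coefficients]): since the rules are not known to be
    confluent, coefficients of ordered forms are read off through linear
    functionals [nf_eval] that are constant along reductions
    ([nf_eval_reduces]) as long as strictly increasing words do not occur; no
    reduction creates such a word.  Sufficiency ([orderable_const]) is an
    explicit sequence of reductions on both sides.  The effect of a rescaling
    on the defining ideal is [rescales_toP]: it is a ring automorphism that
    maps each relator to a unit multiple of a relator of the target. *)

Set Implicit Arguments.
Unset Strict Implicit.
Unset Printing Implicit Defensive.

Import GRing.Theory.
Local Open Scope ring_scope.

(** * Linear algebra of the relators *)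

(** This and the next two identities are stated in an arbitrary module because
    rewriting with module axioms inside the free algebra makes unification
    unfold its operations. *)
Lemma linear_scales_binomial (R : pzRingType) (V : lmodType R)
    (phi : {linear V -> V}) a b a' b' x y z (p q r : V) :
  phi p = x *: p -> phi q = y *: q -> phi r = z *: r ->
  a * y = x * a' -> b * z = x * b' ->
  phi (p - (a *: q + b *: r)) = x *: (p - (a' *: q + b' *: r)).
Proof.
move=> phi_p phi_q phi_r ay bz.
rewrite linearB linearD !linearZ /= phi_p phi_q phi_r.
by rewrite !scalerA ay bz scalerBr scalerDr !scalerA.
Qed.

Lemma scalar_replace (R : comPzRingType) (V : lmodType R) (phi : {scalar V})
    a b c (p q r s : V) :
  phi q = a * phi r + b * phi s ->
  phi (p - c *: q + c *: (a *: r + b *: s)) = phi p.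
Proof.
move=> phi_q; rewrite linearD linearB !linearZ /= phi_q linearD !linearZ /=.
by rewrite subrK.
Qed.

Lemma scaler_replace (R : comPzRingType) (V : lmodType R) (a b c : R)
    (p q r t : V) :
  p - c *: q + c *: (a *: r + b *: t) =
    (- c) *: q + ((c * a) *: r + ((c * b) *: t + p)).
Proof.
by rewrite scaleNr scalerDr !scalerA (addrC p) -addrA (addrC p) -addrA.
Qed.

(** * Rescaling automorphisms of the free algebra *)

Section Rescaling.
Variables (F : fieldType) (n : nat).
Implicit Types (i j k : 'I_n) (a b c : F) (d : 'I_n -> F).
Implicit Types (f g : 'I_n -> 'I_n -> F) (p q r : free_alg F n).
Implicit Types (u v w : word n).

(** Scalars are central although the words do not commute. *)
Lemma mulr_malgC c p : p * c%:MP = c *: p.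
Proof.
rewrite malgM_def fgmulgU malgZ_def; apply: eq_bigr => w _.
by rewrite mulm1 mulrC.
Qed.

Lemma malg_scalerAr c p q : c *: (p * q) = p * (c *: q).
Proof. by rewrite -(mulr_malgC c (p * q)) -mulrA mulr_malgC. Qed.

Lemma malg_scaler_context c p q r : p * (c *: q) * r = c *: (p * q * r).
Proof. by rewrite -malg_scalerAr -scalerAl. Qed.

Lemma mulr_binomial a b p q (x y : free_alg F n) :
  x * (a *: p + b *: q) * y = a *: (x * p * y) + b *: (x * q * y).
Proof. by rewrite mulrDr mulrDl; congr (_ + _); apply: malg_scaler_context. Qed.

Lemma malg_wordM u v :
  << u >> * << v >> = << mmul u v >> :> free_alg F n.
Proof. by rewrite malgM_def fgmulUU mulr1. Qed.

Lemma rescale_additive d : additive (rescale d).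
Proof. exact: mmap_is_additive. Qed.

HB.instance Definition _ d :=
  GRing.isAdditive.Build (free_alg F n) (free_alg F n) (rescale d)
    (rescale_additive d).

Lemma rescaleD d : {morph rescale d : p q / p + q}.
Proof. exact: raddfD. Qed.

Lemma rescale0 d : rescale d 0 = 0.
Proof. exact: raddf0. Qed.

Lemma rescaleB d : {morph rescale d : p q / p - q}.
Proof. exact: raddfB. Qed.

Lemma rescale_multiplicative d : multiplicative (rescale d).
Proof.
pose h (w : word n) : free_alg F n := \prod_(i <- w) (d i *: gen F i).
have hM : mmorphism h.
  by split=> [u v|]; rewrite /h ?fmM ?fm1 ?big_cat ?big_nil.
pose H : {mmorphism word n -> free_alg F n} :=
  HB.pack h (isMultiplicative.Build _ _ h hM).
apply: (@commr_mmap_is_multiplicative _ _ _ (malgC) H) => p m m'.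
by rewrite /GRing.comm mul_malgC mulr_malgC.
Qed.

HB.instance Definition _ d :=
  GRing.isMultiplicative.Build (free_alg F n) (free_alg F n) (rescale d)
    (rescale_multiplicative d).

Lemma rescaleM d : {morph rescale d : p q / p * q}.
Proof. exact: rmorphM. Qed.

Lemma rescale_prod d (s : seq 'I_n) (h : 'I_n -> free_alg F n) :
  rescale d (\prod_(i <- s) h i) = \prod_(i <- s) rescale d (h i).
Proof. exact: rmorph_prod. Qed.

Lemma rescaleC d c : rescale d c%:MP = c%:MP.
Proof. by rewrite /rescale mmapU /= fm1 big_nil mulr1. Qed.

Lemma rescaleZ d c p : rescale d (c *: p) = c *: rescale d p.
Proof. by rewrite -mul_malgC rescaleM rescaleC mul_malgC. Qed.

Lemma rescale_gen d i : rescale d (gen F i) = d i *: gen F i.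
Proof. by rewrite /rescale /gen mmapU /= fmU big_seq1 mpolyC1E mul1r. Qed.

Lemma rescale_genM d j k :
  rescale d (gen F j * gen F k) = (d j * d k) *: (gen F j * gen F k).
Proof.
rewrite (rescaleM d) !rescale_gen.
by rewrite -[_ * _]mulr1 malg_scaler_context mulr1 -scalerAl scalerA mulrC.
Qed.

HB.instance Definition _ d :=
  GRing.isScalable.Build F (free_alg F n) (free_alg F n) *:%R (rescale d)
    (rescaleZ d).

Lemma word_prod_gen (w : word n) : \prod_(i <- w) gen F i = << w >>.
Proof.
rewrite -[w in RHS]fmK; elim: {w}(w : seq _) => [|i s IH].
  by rewrite big_nil -fmoneE.
rewrite big_cons IH /gen malgM_def fgmulUU mulr1; congr << _ *g _ >>.
by apply/eqP; rewrite fmP fmM fmU.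
Qed.

Lemma mkmalgUE c w : << c *g w >> = c *: << w >> :> free_alg F n.
Proof.
by apply/malgP=> v; rewrite [RHS]mcoeffZ [LHS]mcoeffU mcoeffU1 mulr_natr.
Qed.

(** The universal property of the free algebra. *)
Lemma eq_on_gen (phi psi : {lrmorphism free_alg F n -> free_alg F n}) :
  (forall i, phi (gen F i) = psi (gen F i)) -> phi =1 psi.
Proof.
move=> eq_gen p; rewrite [p]monalgE !raddf_sum; apply: eq_bigr => w _.
rewrite mkmalgUE /= !linearZ_LR -word_prod_gen !rmorph_prod; congr (_ *: _).
by apply: eq_bigr => i _; exact: eq_gen.
Qed.

Lemma rescaleK d e p : (forall i, d i * e i = 1) -> rescale e (rescale d p) = p.
Proof.
move=> de1; apply: (@eq_on_gen (rescale e \o rescale d) idfun) => i /=.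
by rewrite rescale_gen rescaleZ rescale_gen scalerA de1 scale1r.
Qed.

(** The factor d_j d_k that a rescaling puts on x^j x^k also appears on
    x^k x^j, so that f must be preserved, whereas x^k x^k gets d_k d_k. *)
Lemma rime_ideal_rescale d f g f' g' p :
  (forall j k : 'I_n, (j < k)%N ->
     f' j k = f j k /\ g' j k * d j = g j k * d k) ->
  rime_ideal f g p -> rime_ideal f' g' (rescale d p).
Proof.
move=> ffgg; elim=> {p} [j k jk||p q _ IHp _ IHq|p q _ IH|p q _ IH].
- have [ff gg] := ffgg j k jk.
  suff -> : rescale d (rime_relator f g j k) =
            (d j * d k) *: rime_relator f' g' j k.
    by rewrite -mul_malgC; apply/RimeIdealMl/RimeRelator.
  apply: (linear_scales_binomial (phi := rescale d) (rescale_genM d j k)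
            (rescale_genM d k j) (rescale_genM d k k)).
    by rewrite ff; ring.
  by rewrite mulrA -gg; ring.
- by rewrite rescale0; apply: RimeIdeal0.
- by rewrite rescaleD; apply: RimeIdealD.
- by rewrite rescaleM; apply: RimeIdealMl.
- by rewrite rescaleM; apply: RimeIdealMr.
Qed.

(** The converse inclusion of ideals is the direct one for the inverse
    rescaling. *)
Lemma rescales_toP d f g f' g' :
  (forall i, d i <> 0) ->
  (forall j k : 'I_n, (j < k)%N ->
     f' j k = f j k /\ g' j k * d j = g j k * d k) ->
  rescales_to d f g f' g'.
Proof.
move=> d0 ffgg; split=> // p; split; first exact: rime_ideal_rescale.
have dN0 i : d i != 0 by apply/eqP/d0.
move=> /(@rime_ideal_rescale (fun i => (d i)^-1) _ _ f g _).
rewrite rescaleK => [|i]; last by rewrite divff.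
apply=> j k /ffgg[-> gg]; split=> //.
by apply/(mulIf (dN0 j))/(mulIf (dN0 k)); rewrite mulfVK // mulrAC -gg; field.
Qed.
End Rescaling.

(** * Functionals invariant under reductions *)

Section RewritingFunctionals.
Variables (F : fieldType) (n : nat) (f g : 'I_n -> 'I_n -> F).
Implicit Types (j k l : 'I_n) (c : F) (p q : free_alg F n) (w : word n).

(* Prescribed values of a functional on the ordered words of length 3. *)
Variable t : 'I_n -> 'I_n -> 'I_n -> F.

(** The value on x^j x^k x^l obtained by m rounds of leftmost reductions. *)
Fixpoint nf_value m j k l : F :=
  if m is m'.+1 then
    if (j < k)%N then f j k * nf_value m' k j l + g j k * nf_value m' k k l
    else if (k < l)%N then
      f k l * nf_value m' j l k + g k l * nf_value m' j l l
    else t j k l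
  else t j k l.

Lemma nf_valueS m j k l :
  nf_value m.+1 j k l =
    if (j < k)%N then f j k * nf_value m k j l + g j k * nf_value m k k l
    else if (k < l)%N then f k l * nf_value m j l k + g k l * nf_value m j l l
    else t j k l.
Proof. by []. Qed.

(** Three rounds of reductions suffice to order a word that is not strictly increasing.
    For j < k < l the longest chains are jjk -> jkk -> kjk -> kkj and
    kjl -> kll -> lkl -> llk; a strictly increasing word needs more. *)
Lemma nf_value_stable j k l :
  ~~ (j < k < l)%N -> nf_value 3 j k l = nf_value 4 j k l.
Proof.
rewrite /=.
case: (ltngtP j k) => [jk|jk|/val_inj <-];
  case: (ltngtP k l) => [kl|kl|/val_inj <-] //=.
all: rewrite ?ltnn //=.
all: try case: (ltngtP j l) => [jl|jl|/val_inj <-] //=.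
all: case: (ltngtP j k) => //.
Qed.

Arguments nf_value : simpl never.

Definition word_value w : F :=
  if w : seq 'I_n is [:: j; k; l] then nf_value 3 j k l else 0.

Definition nf_eval : free_alg F n -> F := mmap idfun word_value.

Lemma nf_eval_additive : additive nf_eval.
Proof. exact: mmap_is_additive. Qed.

Lemma nf_evalZ c p : nf_eval (c *: p) = c * nf_eval p.
Proof.
rewrite /nf_eval (mmapEw (msuppZ_le _ _)) mmapE big_distrr /=.
by apply: eq_bigr => w _; rewrite mcoeffZ mulrA.
Qed.

HB.instance Definition _ :=
  GRing.isAdditive.Build (free_alg F n) F nf_eval nf_eval_additive.

HB.instance Definition _ :=
  GRing.isScalable.Build F (free_alg F n) F *%R nf_eval nf_evalZ.

Lemma nf_eval_word w : nf_eval << w >> = word_value w.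
Proof. by rewrite /nf_eval mmapU mul1r. Qed.

Lemma rhs_in_context (u v : word n) j k :
  << u >> * rime_rhs f g j k * << v >> =
    f j k *: << mmul u (mmul (fmu k) (mmul (fmu j) v)) >>
  + g j k *: << mmul u (mmul (fmu k) (mmul (fmu k) v)) >>.
Proof.
by rewrite /rime_rhs mulr_binomial /gen !malg_wordM -!mulmA.
Qed.

Definition increasing w := sorted (fun j k => (j < k)%N) w.

(** A word of length 3 that is not strictly increasing has at most one place
    where a rule applies, so that the leftmost strategy of [nf_value] makes no
    choice. *)
Lemma word_value_reduce (u v : word n) j k :
  (j < k)%N -> ~~ increasing (mmul u (mmul (fmu j) (mmul (fmu k) v))) ->
  word_value (mmul u (mmul (fmu j) (mmul (fmu k) v))) =
    f j k * word_value (mmul u (mmul (fmu k) (mmul (fmu j) v)))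
  + g j k * word_value (mmul u (mmul (fmu k) (mmul (fmu k) v))).
Proof.
move=> jk; rewrite /increasing /word_value !fmM !fmU.
case: u v => [[|a [|b s]]] [[|c [|e r]]] //=; rewrite ?(mulr0, addr0) //.
- by rewrite andbT => nlt; rewrite nf_value_stable // nf_valueS jk.
- rewrite jk !andbT => nlt.
  by rewrite nf_value_stable ?nf_valueS ?jk ?andbT // (negbTE nlt).
all: by case: s => [|x [|y s]] _ /=; rewrite !mulr0 addr0.
Qed.

Definition no_increasing_word p := forall w, p@_w <> 0 -> ~~ increasing w.

(** The right-hand side of every rule has a factor x^k x^j or x^k x^k with
    j < k, so that reductions create no strictly increasing word. *)
Lemma not_increasing_descent (u v : word n) j k :
  (k <= j)%N -> ~~ increasing (mmul u (mmul (fmu j) (mmul (fmu k) v))).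
Proof.
move=> kj; rewrite /increasing !fmM !fmU; case: (u : seq _) => [|a s] /=.
  by rewrite (ltnNge j k) kj.
by rewrite cat_path /= (ltnNge j k) kj !andbF.
Qed.

Lemma no_increasing_word1 w : ~~ increasing w -> no_increasing_word << w >>.
Proof. by move=> nw v; rewrite mcoeffU1; case: eqP => // <-. Qed.

Lemma no_increasing_wordD p q :
  no_increasing_word p -> no_increasing_word q -> no_increasing_word (p + q).
Proof.
move=> Sp Sq w; rewrite mcoeffD.
have [p0|/eqP/Sp //] := eqVneq p@_w 0.
by rewrite p0 add0r => /Sq.
Qed.

Lemma no_increasing_wordZ c p :
  no_increasing_word p -> no_increasing_word (c *: p).
Proof.
by move=> Sp w; rewrite mcoeffZ => /eqP; rewrite mulf_eq0 => /norP[_ /eqP/Sp].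
Qed.

Lemma nf_eval_reduces p q :
  reduces f g p q -> no_increasing_word p ->
  no_increasing_word q /\ nf_eval q = nf_eval p.
Proof.
elim=> {p q} [p q|p|p q r _ IHpq _ IHqr Sp]; last first.
- have [Sq <-] := IHpq Sp; exact: IHqr.
- by [].
case=> [u [v [j [k [jk ->]]]]] Sp.
set w := mmul u _; have [->|/eqP/Sp nw] := eqVneq p@_w 0.
  by rewrite !scale0r subr0 addr0.
rewrite rhs_in_context; split.
  rewrite -scaleNr; apply: no_increasing_wordD.
    apply: no_increasing_wordD => //.
    exact/no_increasing_wordZ/no_increasing_word1.
  apply/no_increasing_wordZ/no_increasing_wordD;
    apply/no_increasing_wordZ/no_increasing_word1/not_increasing_descent => //.
  exact: ltnW.
apply: (scalar_replace (phi := nf_eval)).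
by rewrite /= !nf_eval_word -word_value_reduce.
Qed.
End RewritingFunctionals.

(** * Reductions of explicit cubic elements *)

Section Cubic.
Variables (F : fieldType) (n : nat).
Implicit Types (f g : 'I_n -> 'I_n -> F) (i j k l : 'I_n) (c : F).

Notation cubic := (seq (F * ('I_n * 'I_n * 'I_n))).
Implicit Types s : cubic.

Definition word3 (m : 'I_n * 'I_n * 'I_n) : word n :=
  FMonom [:: m.1.1; m.1.2; m.2].

(** Cubic elements are given by lists of terms, with repetitions allowed: the
    coefficients that the reductions need then live in F, where they can be
    computed. *)
Definition expand s : free_alg F n := \sum_(x <- s) x.1 *: << word3 x.2 >>.

Definition coef s m : F := \sum_(x <- s) x.1 * (x.2 == m)%:R.

Lemma word3_inj : injective word3.
Proof. by move=> [[i j] k] [[i' j'] k'] [-> -> ->]. Qed.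

Lemma word3E i j k : word3 (i, j, k) = mmul (fmu i) (mmul (fmu j) (fmu k)).
Proof. by apply/eqP; rewrite fmP !fmM !fmU. Qed.

Lemma mcoeff_expand s w :
  (expand s)@_w = \sum_(x <- s) x.1 * (word3 x.2 == w)%:R.
Proof.
rewrite /expand raddf_sum; apply: eq_bigr => x _.
by rewrite /= mcoeffZ mcoeffU1.
Qed.

Lemma mcoeff_expand3 s m : (expand s)@_(word3 m) = coef s m.
Proof.
by rewrite mcoeff_expand; apply: eq_bigr => x _; rewrite (inj_eq word3_inj).
Qed.

Lemma eq_expand s s' : coef s =1 coef s' -> expand s = expand s'.
Proof.
move=> eq_coef; apply/malgP => -[[|i [|j [|k [|l w]]]]].
(* Words of length 3; on all others both sides vanish. *)
4: exact: (etrans (mcoeff_expand3 s (i, j, k)))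
              (etrans (eq_coef _) (esym (mcoeff_expand3 s' (i, j, k)))).
all: rewrite !mcoeff_expand !big1 // => x _.
all: by rewrite fmP /= ?eqseq_cons ?andbF mulr0.
Qed.

Lemma expand_cons c m s : expand ((c, m) :: s) = c *: << word3 m >> + expand s.
Proof. exact: big_cons. Qed.

(** A reduction subtracts the reduced word instead of erasing it from the
    list, so that the list just grows. *)
Lemma reduces_left f g i j k c s q :
  (i < j)%N -> coef s (i, j, k) = c ->
  reduces f g (expand [:: (- c, (i, j, k)), (c * f i j, (j, i, k)),
                          (c * g i j, (j, j, k)) & s]) q ->
  reduces f g (expand s) q.
Proof.
move=> ij cE; apply/rt_trans/rt_step.
exists (mone : word n), (fmu k), i, j; split=> //=.
rewrite !mul1m -word3E mcoeff_expand3 cE rhs_in_context !mul1m -!word3E.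
rewrite scaler_replace.
by rewrite !expand_cons.
Qed.

Lemma reduces_right f g i j k c s q :
  (j < k)%N -> coef s (i, j, k) = c ->
  reduces f g (expand [:: (- c, (i, j, k)), (c * f j k, (i, k, j)),
                          (c * g j k, (i, k, k)) & s]) q ->
  reduces f g (expand s) q.
Proof.
move=> jk cE; apply/rt_trans/rt_step.
exists (fmu i), (mone : word n), j, k; split=> //=.
rewrite !mulm1 -word3E mcoeff_expand3 cE rhs_in_context !mulm1 -!word3E.
rewrite scaler_replace.
by rewrite !expand_cons.
Qed.

Lemma expand2 a b m m' :
  expand [:: (a, m); (b, m')] = a *: << word3 m >> + b *: << word3 m' >>.
Proof. by rewrite expand_cons; congr (_ + _); apply: big_seq1. Qed.

Lemma rime_rhs_mull f g i j k :
  rime_rhs f g i j * gen F k =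
    expand [:: (f i j, (j, i, k)); (g i j, (j, j, k))].
Proof.
transitivity (<< mone >> * rime_rhs f g i j * << fmu k >>).
  by congr (_ * _); rewrite mpolyC1E mul1r.
by rewrite rhs_in_context !mul1m -!word3E expand2.
Qed.

Lemma rime_rhs_mulr f g i j k :
  gen F i * rime_rhs f g j k =
    expand [:: (f j k, (i, k, j)); (g j k, (i, k, k))].
Proof.
transitivity (<< fmu i >> * rime_rhs f g j k * << mone >>).
  by rewrite mpolyC1E mulr1.
by rewrite rhs_in_context !mulm1 -!word3E expand2.
Qed.
End Cubic.

(** * The overlap conditions *)

Section Classification.
Variables (F : fieldType) (n : nat).
Implicit Types (f g : 'I_n -> 'I_n -> F) (i j k l : 'I_n) (c : F).
Implicit Types (t : 'I_n -> 'I_n -> 'I_n -> F).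

Lemma ord_lt_eqF j k : (j < k)%N -> ((j == k) = false) * ((k == j) = false).
Proof. by move=> jk; rewrite -val_eqE /= ltn_eqF // -val_eqE /= gtn_eqF. Qed.

Lemma nf_eval_expand f g t s :
  nf_eval f g t (expand s) =
    \sum_(x <- s) x.1 * nf_value f g t 3 x.2.1.1 x.2.1.2 x.2.2.
Proof.
rewrite /expand raddf_sum; apply: eq_bigr => x _ /=.
by rewrite nf_evalZ nf_eval_word.
Qed.

Lemma orderable_nf_value f g j k l t :
  orderable f g -> (j < k)%N -> (k < l)%N ->
  f j k * nf_value f g t 3 k j l + g j k * nf_value f g t 3 k k l =
  f k l * nf_value f g t 3 j l k + g k l * nf_value f g t 3 j l l.
Proof.
move=> ord jk kl; have [q [[redl _] [redr _]]] := ord j k l jk kl.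
have overlap_supp a b m m' :
    ~~ increasing (word3 m) -> ~~ increasing (word3 m') ->
  no_increasing_word (expand [:: (a : F, m); (b, m')]).
- by move=> im im'; rewrite expand2; apply: no_increasing_wordD;
    apply/no_increasing_wordZ/no_increasing_word1.
rewrite rime_rhs_mull in redl; rewrite rime_rhs_mulr in redr.
have [|_ evl] := nf_eval_reduces t redl;
  last have [|_ evr] := nf_eval_reduces t redr.
- by apply: overlap_supp; rewrite /increasing /= ?ltnn // ltnNge (ltnW jk).
- apply: overlap_supp; rewrite /increasing /= ?ltnn ?andbF //.
  by rewrite (ltnNge l) (ltnW kl) andbF.
by move: evl; rewrite evr !nf_eval_expand !big_cons !big_nil !addr0 => ->.
Qed.

(** Both ordered forms of x^j x^k x^l, read through an arbitrary functional:
    the values of t are the ordered monomials. *)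
Lemma nf_value_overlap f g j k l t :
  orderable f g -> (j < k)%N -> (k < l)%N ->
  f j k * (f j l * (f k l * t l k j + g k l * t l l j) +
           g j l * (f k l * (f k l * t l l k + g k l * t l l l) +
                    g k l * t l l l)) +
  g j k * (f k l * (f k l * t l k k + g k l * t l l k) +
           g k l * (f k l * (f k l * t l l k + g k l * t l l l) +
                    g k l * t l l l)) =
  f k l * (f j l * (f j k * t l k j + g j k * t l k k) + g j l * t l l k) +
  g k l * (f j l * (f j l * t l l j + g j l * t l l l) + g j l * t l l l).
Proof.
move=> ord jk kl; have jl := ltn_trans jk kl.
have prune := (ltnn, jk, kl, jl, leq_gtF (ltnW jk), leq_gtF (ltnW kl),
               leq_gtF (ltnW jl)).
have := orderable_nf_value t ord jk kl.
rewrite ![nf_value _ _ _ 3 _ _ _]nf_valueS !prune.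
rewrite ![nf_value _ _ _ 2 _ _ _]nf_valueS !prune.
by rewrite ![nf_value _ _ _ 1 _ _ _]nf_valueS !prune.
Qed.

(** Compare the coefficients on x^l x^l x^j, x^l x^k x^k and x^l x^l x^k. *)
Lemma overlap_coefficients f g j k l :
  strict f g -> orderable f g -> (j < k)%N -> (k < l)%N ->
  [/\ f j k = f j l, f k l = f j l &
      (1 + f j l) * (g j k * g k l - (1 - f j l) * g j l) = 0].
Proof.
move=> str ord jk kl; have jl := ltn_trans jk kl.
have [/eqP fjl0 /eqP gjl0] := str j l jl.
have [/eqP fkl0 /eqP gkl0] := str k l kl.
have [/eqP fjk0 /eqP gjk0] := str j k jk.
have eqE' := (ord_lt_eqF jk, ord_lt_eqF kl, ord_lt_eqF jl).
have eqE := (xpair_eqE, eqxx, eqE', mulr0, mulr1, addr0, add0r).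
have overlap m := nf_value_overlap (fun x y z => ((x, y, z) == m)%:R) ord jk kl.
have fjkE : f j k = f j l.
  have := overlap (l, l, j); rewrite !eqE /= => e.
  by apply: (mulIf fjl0); apply: (mulIf gkl0); ring: e.
have fklE : f k l = f j l.
  have := overlap (l, k, k); rewrite !eqE /= => e.
  by apply: (mulIf fkl0); apply: (mulIf gjk0); ring: e.
split=> //; have := overlap (l, l, k); rewrite !eqE /= fjkE fklE => /eqP.
rewrite -subr_eq0 => /eqP e.
by apply: (mulIf fjl0); rewrite mul0r -[RHS]e; ring.
Qed.

(** The ordered form of x^j x^k x^l for constant f, as obtained by starting
    with the factor x^k x^l. *)
Definition normal_overlap c g j k l :=
  [:: (c ^+ 3, (l, k, j)); (c ^+ 2 * g j k, (l, k, k)); (c * g j l, (l, l, k));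
      (c ^+ 2 * g k l, (l, l, j)); ((1 + c) * g j l * g k l, (l, l, l))].

Lemma ordered_expand (s : seq (F * ('I_n * 'I_n * 'I_n))) :
  all (fun x => sorted (fun a b : 'I_n => (b <= a)%N) (word3 x.2)) s ->
  ordered (expand s).
Proof.
move=> /allP ord_s w; apply: contra_notT => unsorted.
rewrite mcoeff_expand big_seq big1 // => x /ord_s ord_x.
by case: eqP => [eq_w|]; rewrite ?mulr0 //; rewrite -eq_w ord_x in unsorted.
Qed.

(** The two ordered forms of x^j x^k x^l differ by the multiple
    c x^l x^l x^k + g k l x^l x^l x^l of the hypothesis. *)
Lemma orderable_const c g :
  (forall j k l, (j < k)%N -> (k < l)%N ->
     (1 + c) * (g j k * g k l - (1 - c) * g j l) = 0) ->
  orderable (fun _ _ => c) g.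
Proof.
move=> hg j k l jk kl; have E := hg j k l jk kl.
have jl := ltn_trans jk kl.
have eqE := (xpair_eqE, eqxx, ord_lt_eqF jk, ord_lt_eqF kl, ord_lt_eqF jl).
have ordq : ordered (expand (normal_overlap c g j k l)).
  by apply: ordered_expand; rewrite /= !leqnn (ltnW jk) (ltnW kl) (ltnW jl).
exists (expand (normal_overlap c g j k l)); split; split=> //.
(* In each step (c := _) is the coefficient of the word that gets reduced. *)
- rewrite rime_rhs_mull /=.
  apply: (reduces_right (i := k) (c := c) jl);
    first by rewrite /coef !big_cons big_nil /= !eqE /=; ring.
  apply: (reduces_right (i := k) (c := g j k) kl);
    first by rewrite /coef !big_cons big_nil /= !eqE /=; ring.
  apply: (reduces_left (k := l) (c := c * g j l + g j k * g k l) kl);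
    first by rewrite /coef !big_cons big_nil /= !eqE /=; ring.
  apply: (reduces_left (k := k) (c := g j k * c) kl);
    first by rewrite /coef !big_cons big_nil /= !eqE /=; ring.
  apply: (reduces_left (k := j) (c := c * c) kl);
    first by rewrite /coef !big_cons big_nil /= !eqE /=; ring.
  apply: (reduces_right (i := l) (c := c * (c * g j l + g j k * g k l)) kl);
    first by rewrite /coef !big_cons big_nil /= !eqE /=; ring.
  rewrite (@eq_expand _ _ _ (normal_overlap c g j k l)); first exact: rt_refl.
  move=> m; apply/eqP; rewrite -subr_eq0 /coef !big_cons !big_nil /=; apply/eqP.
  rewrite -[RHS](mulr0 (c * ((l, l, k) == m)%:R + g k l * ((l, l, l) == m)%:R)).
  by rewrite -E; ring.
- rewrite rime_rhs_mulr /=.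
  apply: (reduces_left (k := k) (c := c) jl);
    first by rewrite /coef !big_cons big_nil /= !eqE /=; ring.
  apply: (reduces_left (k := l) (c := g k l) jl);
    first by rewrite /coef !big_cons big_nil /= !eqE /=; ring.
  apply: (reduces_right (i := l) (c := c * c) jk);
    first by rewrite /coef !big_cons big_nil /= !eqE /=; ring.
  apply: (reduces_right (i := l) (c := g k l * c) jl);
    first by rewrite /coef !big_cons big_nil /= !eqE /=; ring.
  rewrite (@eq_expand _ _ _ (normal_overlap c g j k l)); first exact: rt_refl.
  move=> m; apply/eqP; rewrite -subr_eq0 /coef !big_cons !big_nil /=; apply/eqP.
  by ring.
Qed.

End Classification.

(** * Classification *)

Section StrictOrderable.
Variable F : fieldType.

(** f j k = f 0 k = f 0 n: an overlap identifies the values of f on any two of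
    its three pairs. *)
Lemma orderable_const_f n (f g : 'I_n.+1 -> 'I_n.+1 -> F) (j k : 'I_n.+1) :
  strict f g -> orderable f g -> (j < k)%N -> f j k = f ord0 ord_max.
Proof.
move=> str ord jk; have k0 : (0 < k)%N by apply: leq_ltn_trans jk.
have -> : f j k = f ord0 k.
  have [j0|j0] := posnP j; first by congr f; apply: val_inj.
  by have [] := overlap_coefficients str ord (j := ord0) j0 jk.
have [-> //|] := eqVneq k ord_max.
rewrite -val_eqE neq_ltn /= => /orP[kmax|].
  by have [] := overlap_coefficients str ord (j := ord0) (l := ord_max) k0 kmax.
by rewrite ltnNge -ltnS ltn_ord.
Qed.

(** The cocycle g / (1 - c) is a coboundary; d normalises g 0 k to 1 - c. *)
Lemma rescales_cocycle n (f g : 'I_n -> 'I_n -> F) c :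
  strict f g -> c <> 1 -> (forall j k : 'I_n, (j < k)%N -> f j k = c) ->
  (forall j k l : 'I_n, (j < k)%N -> (k < l)%N ->
     g j k * g k l = (1 - c) * g j l) ->
  exists d, rescales_to d f g (fun _ _ => c) (fun _ _ => 1 - c).
Proof.
case: n f g => [|n] f g str c1 fc cocycle.
  by exists (fun=> 1); apply: rescales_toP => [i|[]] //; apply/eqP/oner_neq0.
have c1N0 : 1 - c != 0 by rewrite subr_eq0 eq_sym; apply/eqP.
have g0 (j k : 'I_n.+1) : (j < k)%N -> g j k != 0.
  by move=> jk; have [_ /eqP] := str j k jk.
pose d (i : 'I_n.+1) := if i == ord0 then 1 else (1 - c) / g ord0 i.
exists d; apply: rescales_toP => [i|j k jk].
  apply/eqP; rewrite /d.
  case: (i =P ord0) => [_|/eqP i0]; first exact: oner_neq0.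
  by rewrite mulf_neq0 ?invr_neq0 // g0 // lt0n.
split; first by rewrite fc.
have k0 : (0 < k)%N by apply: leq_ltn_trans jk.
have gk0 : g ord0 k != 0 by apply: g0.
rewrite /d [k == _](_ : _ = false); last by rewrite -val_eqE gtn_eqF.
case: (j =P ord0) => [j0|/eqP j0].
  by rewrite -j0 mulr1 mulrCA divff ?mulr1 // j0.
have gj0 : g ord0 j != 0 by rewrite g0 // lt0n.
have := cocycle ord0 j k; rewrite lt0n => /(_ j0 jk) e.
have -> : g j k = (1 - c) * g ord0 k / g ord0 j.
  by apply: (mulfI gj0); rewrite e; field.
by field; rewrite gk0 gj0.
Qed.
End StrictOrderable.

Theorem proposition14 (F : fieldType) (n : nat) :
  (forall f g : 'I_n -> 'I_n -> F,
     strict f g -> orderable f g ->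
     (n = 2%N -> forall j k : 'I_n, (j < k)%N -> f j k <> 1) ->
     exists d : 'I_n -> F,
       (exists g' : 'I_n -> 'I_n -> F,
          strict (fun _ _ => -1) g' /\
          rescales_to d f g (fun _ _ => -1) g')
       \/
       (exists c : F, c <> 0 /\ c <> 1 /\
          rescales_to d f g (fun _ _ => c) (fun _ _ => 1 - c)))
  /\
  (forall g : 'I_n -> 'I_n -> F,
     orderable (fun _ _ => -1) g /\
     ((forall j k : 'I_n, (j < k)%N -> g j k <> 0) ->
      strict (fun _ _ => -1) g))
  /\
  (forall c : F,
     orderable (fun _ _ : 'I_n => c) (fun _ _ => 1 - c) /\
     (c <> 0 -> c <> 1 ->
      strict (fun _ _ : 'I_n => c) (fun _ _ => 1 - c))).
Proof.
split; last first.
  split=> [g|c]; split.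
  - by apply: orderable_const => j k l _ _; ring.
  - move=> g0 j k jk; split; last exact: g0.
    by apply/eqP; rewrite oppr_eq0 oner_neq0.
  - by apply: orderable_const => j k l _ _; ring.
  - move=> c0 c1 j k _; split=> // /eqP.
    by rewrite subr_eq0 eq_sym => /eqP.
move=> f g str ord f1.
have case_i : (forall j k : 'I_n, (j < k)%N -> f j k = -1) ->
    exists d : 'I_n -> F, exists g' : 'I_n -> 'I_n -> F,
      strict (fun _ _ => -1) g' /\ rescales_to d f g (fun _ _ => -1) g'.
  move=> fN1; exists (fun=> 1), g; split.
    by move=> j k /[dup] /fN1 <-; apply: str.
  apply: rescales_toP => [_|j k /fN1 ->]; first exact/eqP/oner_neq0.
  by rewrite !mulr1.
have case_ii c : c <> 0 -> c <> 1 ->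
    (forall j k : 'I_n, (j < k)%N -> f j k = c) ->
    (forall j k l : 'I_n, (j < k)%N -> (k < l)%N ->
       g j k * g k l = (1 - c) * g j l) ->
    exists d : 'I_n -> F, exists c : F, c <> 0 /\ c <> 1 /\
      rescales_to d f g (fun _ _ => c) (fun _ _ => 1 - c).
  move=> c0 c1 fc cocycle; have [d] := rescales_cocycle str c1 fc cocycle.
  by exists d, c.
case: n => [|n] in f g str ord f1 case_i case_ii *.
  by have [[] //|d ?] := case_i; exists d; left.
have fc := orderable_const_f str ord; set c := f ord0 ord_max in fc.
have [cN1|/eqP cN1] := c =P -1.
  by have [j k /fc ->//|d ?] := case_i; exists d; left.
have [n0|n_gt0] := posnP n.
  have [j k jk|d ?] := case_i; last by exists d; left.
  have := leq_trans (leq_ltn_trans (leq0n j) jk) (ltn_ord k : (k <= n)%N).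
  by rewrite n0.
have c0 : c <> 0 by have [] := str ord0 ord_max n_gt0.
have cocycle (j k l : 'I_n.+1) :
  (j < k)%N -> (k < l)%N -> g j k * g k l = (1 - c) * g j l.
- move=> jk kl; have [_ _] := overlap_coefficients str ord jk kl.
  rewrite fc ?(ltn_trans jk) // => /eqP; rewrite mulf_eq0 subr_eq0.
  by rewrite addrC addr_eq0 (negPf cN1) => /eqP.
have c1 : c <> 1.
  have [n1|n_gt1] := leqP n 1.
    apply: (f1 _ ord0 ord_max n_gt0); congr _.+1.
    by apply/eqP; rewrite eqn_leq n1.
  pose i1 : 'I_n.+1 := Ordinal (ltnW n_gt1 : (1 < n.+1)%N).
  have [_ g01] := str ord0 i1 isT; have [_ g1n] := str i1 ord_max n_gt1.
  move=> c1; have /eqP := cocycle ord0 i1 ord_max isT n_gt1.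
  by rewrite c1 subrr mul0r mulf_eq0 => /orP[] /eqP.
by have [d ?] := case_ii c c0 c1 fc cocycle; exists d; right.
Qed.
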